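(* Let $m,n\ge 3$ and $l\ge -1$ be integers. Then $$X_{D(m,l,n)}=(m-1)(n-1)X_{P_{m+l+n}}-(m-1)\sum_{i=2}^{n-1}X_{P_{m+l+n-i}}X_{C_i}-(n-1)\sum_{j=2}^{m-1}X_{P_{m+l+n-j}}X_{C_j}+\sum_{i=2}^{n-1}\sum_{j=2}^{m-1}X_{P_{m+l+n-i-j}}X_{C_i}X_{C_j}.$$
   Context: All graphs are finite and simple; $C_n$ is the cycle (for $n\ge 3$) and $P_l$ the path on the indicated number of vertices. By convention $C_2$ means $P_2$. For $m,n\ge 3$ and $l\ge 2$, the dumbbell graph $D(m,l,n)$ consists of disjoint $C_m$, $C_n$ and $P_l$, with one leaf of $P_l$ connected by an edge to one vertex of $C_m$ and the other leaf connected by an edge to one vertex of $C_n$. For $l=1$, the single vertex of $P_1$ is adjacent to one vertex of $C_m$ and to one vertex of $C_n$. For $l=0$, $D(m,0,n)$ is $C_m$ and $C_n$ (disjoint) connected by an edge. For $l=-1$, $D(m,-1,n)$ is $C_m$ and $C_n$ sharing exactly one vertex. The chromatic symmetric function of a graph $G$ with vertices $v_1,\ldots,v_d$ is $X_G=\sum_{\kappa} x_{\kappa(v_1)}\cdots x_{\kappa(v_d)}$, the sum over all proper colourings $\kappa:V(G)\to\mathbb{N}$, with $x_1,x_2,\ldots$ commuting variables. *)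

(* Defs.v *)
From HB Require Import structures.
From mathcomp Require Import all_boot all_order all_algebra finmap multiset.
From mathcomp Require Import boolp classical_sets functions cardinality fsbigop.
Set Implicit Arguments.
Unset Strict Implicit.
Unset Printing Implicit Defensive.
Import GRing.Theory.
Local Open Scope classical_set_scope.
Local Open Scope ring_scope.

(* Formal power series over int in the commuting variables x_0, x_1, x_2, ...
   A monomial is the finite multiset of the indices of its variables, so that
   the product of monomials is the sum of multisets; a series is the function
   giving the coefficient of each monomial. *)
Definition fpseries := {mset nat}%mset -> int.

HB.instance Definition _ :=
  GRing.Zmodule.copy fpseries ({mset nat}%mset -> int).

Definition fpvar (i : nat) : fpseries := fun M => (M == [mset i]%mset)%:R.

Definition fps_one : fpseries := fun M => (M == mset0)%:R.

(* The Cauchy product; by [finite_mset_decomp] below, the sum is finite. *)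
Definition fps_mul (f g : fpseries) : fpseries := fun M =>
  \sum_(p \in [set p : {mset nat}%mset * {mset nat}%mset
                 | (p.1 `+` p.2)%mset = M]) f p.1 * g p.2.

Definition submsets (D : {mset nat}%mset) : seq {mset nat}%mset :=
  undup [seq seq_mset (mask t D) | t : (size D).-tuple bool].

Lemma mem_submsets (D A : {mset nat}%mset) :
  (A `<=` D)%mset -> A \in submsets D.
Proof.
move=> /msubsetP sAD; rewrite mem_undup.
have /count_maskP[t /eqP szt pAt] :
    forall x, (count_mem x A <= count_mem x D)%N.
  by move=> x; rewrite !count_mem_mset.
apply/mapP; exists (Tuple szt); first by rewrite mem_enum.
by rewrite -[LHS]seq_mset_id; apply/eq_seq_msetP.
Qed.

Lemma msubset_addl (A B : {mset nat}%mset) : (A `<=` A `+` B)%mset.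
Proof. by apply/msubsetP => x; rewrite msetE2 leq_addr. Qed.

Lemma msubset_addr (A B : {mset nat}%mset) : (B `<=` A `+` B)%mset.
Proof. by rewrite msetDC msubset_addl. Qed.

Lemma finite_mset_decomp (M : {mset nat}%mset) :
  finite_set [set p : {mset nat}%mset * {mset nat}%mset
                | (p.1 `+` p.2)%mset = M].
Proof.
apply: (@sub_finite_set _ _
  [set` [seq (a, b) | a <- submsets M, b <- submsets M]]); last first.
  exact: finite_seq.
move=> [a b] /= <-; apply/allpairsP; exists (a, b).
by split => //; apply: mem_submsets; rewrite ?msubset_addl ?msubset_addr.
Qed.

Lemma fps_mulE (f g : fpseries) (D M : {mset nat}%mset) : (M `<=` D)%mset ->
  fps_mul f g M = \sum_(a <- submsets D) \sum_(b <- submsets D)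
    if (a `+` b)%mset == M then f a * g b else 0.
Proof.
move=> sMD; rewrite /fps_mul.
pose r := [seq p <- [seq (a, b) | a <- submsets D, b <- submsets D]
          | (p.1 `+` p.2)%mset == M].
have ur : uniq r.
  by rewrite filter_uniq// allpairs_uniq ?undup_uniq// => -[? ?] [? ?].
have -> : [set p : {mset nat}%mset * {mset nat}%mset
             | (p.1 `+` p.2)%mset = M] = [set` r].
  apply/seteqP; split => -[a b] /=; rewrite mem_filter /=; last first.
    by case/andP => /eqP.
  move=> abM; rewrite abM eqxx /=; apply/allpairsP; exists (a, b).
  split=> //; apply: mem_submsets; apply: msubset_trans sMD;
  by rewrite -abM ?msubset_addl ?msubset_addr.
rewrite -fsbig_seq// big_filter big_mkcond /= big_allpairs.
by [].
Qed.

Lemma fps_mulC : commutative fps_mul.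
Proof.
move=> f g; apply/funext => M.
rewrite !(@fps_mulE _ _ M)// ?msubset_refl// exchange_big /=.
by apply: eq_bigr => a _; apply: eq_bigr => b _; rewrite msetDC mulrC.
Qed.

Lemma big_submsets (D c : {mset nat}%mset) (F : {mset nat}%mset -> int) :
  (c `<=` D)%mset ->
  \sum_(a <- submsets D) (if c == a then F a else 0) = F c.
Proof.
move=> sD; rewrite -big_mkcond /= (big_rem c) ?mem_submsets//= eqxx.
rewrite big_seq_cond big1 ?addr0// => a /andP[].
rewrite mem_rem_uniq ?undup_uniq// !inE => /andP[/eqP nac _] /eqP cE.
by rewrite cE in nac.
Qed.

Lemma fps_mul3E (f g h : fpseries) (M : {mset nat}%mset) :
  fps_mul (fps_mul f g) h M =
  \sum_(a <- submsets M) \sum_(b <- submsets M) \sum_(c <- submsets M)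
    if (a `+` b `+` c)%mset == M then f a * g b * h c else 0.
Proof.
rewrite (@fps_mulE _ _ M)// ?msubset_refl//.
transitivity (\sum_(e <- submsets M) \sum_(a <- submsets M)
    \sum_(b <- submsets M) \sum_(c <- submsets M)
    if (a `+` b)%mset == e then
      if (e `+` c)%mset == M then f a * g b * h c else 0 else 0).
  rewrite big_seq [RHS]big_seq; apply: eq_bigr => e.
  rewrite mem_undup => /mapP[t _ eE].
  have seM : (e `<=` M)%mset.
    apply/msubsetP => x; rewrite eE mset_seqE -[leqRHS](count_mem_mset x M).
    exact: leq_count_mask.
  rewrite (@fps_mulE _ _ M)//.
  transitivity (\sum_(c <- submsets M) \sum_(a <- submsets M)
     \sum_(b <- submsets M)
    if (a `+` b)%mset == e then
      if (e `+` c)%mset == M then f a * g b * h c else 0 else 0).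
    apply: eq_bigr => c _; case: ifP => _; last first.
      by rewrite big1// => a _; rewrite big1// => b _; case: ifP.
    rewrite mulr_suml; apply: eq_bigr => a _; rewrite mulr_suml.
    by apply: eq_bigr => b _; case: ifP; rewrite ?mul0r.
  rewrite exchange_big; apply: eq_bigr => a _ /=.
  by rewrite exchange_big.
rewrite exchange_big; apply: eq_bigr => a _ /=.
rewrite exchange_big; apply: eq_bigr => b _ /=.
rewrite exchange_big; apply: eq_bigr => c _ /=.
have [sM|nsM] := boolP (a `+` b `<=` M)%mset.
  by rewrite (big_submsets
    (fun e => if (e `+` c)%mset == M then f a * g b * h c else 0) sM).
rewrite ifN; last by apply: contra nsM => /eqP <-; rewrite msubset_addl.
rewrite big1// => e _; case: eqP => // <-.
by rewrite ifN//; apply: contra nsM => /eqP <-; rewrite msubset_addl.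
Qed.

Lemma fps_mulA : associative fps_mul.
Proof.
move=> f g h; rewrite [LHS]fps_mulC; apply/funext => M.
rewrite !fps_mul3E [RHS]exchange_big; apply: eq_bigr => b _ /=.
rewrite [RHS]exchange_big /=; apply: eq_bigr => c _.
apply: eq_bigr => a _.
by rewrite msetDC msetDA [g b * h c * f a]mulrC mulrA.
Qed.

Lemma fps_mul1 : left_id fps_one fps_mul.
Proof.
move=> f; apply/funext => M; rewrite (@fps_mulE _ _ M) ?msubset_refl//.
transitivity (\sum_(a <- submsets M)
    if mset0 == a then \sum_(b <- submsets M) if M == b then f b else 0 else 0).
  apply: eq_bigr => a _; rewrite /fps_one eq_sym.
  case: eqP => [<-|_]; last by rewrite big1// => b _; rewrite mul0r; case: ifP.
  by apply: eq_bigr => b _; rewrite mset0D mul1r eq_sym.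
rewrite (big_submsets (fun=> _)) ?big_submsets ?msubset_refl//.
by apply/msubsetP => x; rewrite mset0E.
Qed.

Lemma fps_mulDl : left_distributive fps_mul +%R.
Proof.
move=> f g h; apply/funext => M.
rewrite [RHS]/GRing.add /= !(@fps_mulE _ _ M) ?msubset_refl// -big_split.
apply: eq_bigr => a _; rewrite -big_split; apply: eq_bigr => b _ /=.
by case: ifP; rewrite ?addr0// -mulrDl.
Qed.

Lemma fps_one_neq0 : fps_one != 0.
Proof.
by apply/eqP => /(congr1 (fun f : fpseries => f mset0)); rewrite /fps_one eqxx.
Qed.

HB.instance Definition _ := GRing.Zmodule_isComNzRing.Build fpseries
  fps_mulA fps_mulC fps_mul1 fps_mulDl fps_one_neq0.

Record sgraph := SGraph {
  svertex :> finType;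
  sadj : rel svertex;
  sadj_sym : symmetric sadj;
  sadj_irr : irreflexive sadj }.

Section GraphOfRel.
Variables (T : finType) (r : rel T).

Definition simple_closure : rel T := fun x y => (x != y) && (r x y || r y x).

Lemma simple_closure_sym : symmetric simple_closure.
Proof. by move=> x y; rewrite /simple_closure eq_sym orbC. Qed.

Lemma simple_closure_irr : irreflexive simple_closure.
Proof. by move=> x; rewrite /simple_closure eqxx. Qed.

Definition graph_of_rel : sgraph :=
  SGraph simple_closure_sym simple_closure_irr.
End GraphOfRel.

Definition path_step (i j : nat) : bool := j == i.+1.
Definition cycle_step (n i j : nat) : bool := j == (i.+1 %% n)%N.

Definition path_graph (k : nat) : sgraph :=
  graph_of_rel (fun i j : 'I_k => path_step i j).

Definition cycle_graph (n : nat) : sgraph :=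
  graph_of_rel (fun i j : 'I_n => cycle_step n i j).

(* The convention C_2 = P_2. *)
Lemma cycle_graph2 :
  @sadj (cycle_graph 2) =2 @sadj (path_graph 2).
Proof. by case=> [[|[|x]] ?]; case=> [[|[|y]] ?]. Qed.

(* For l >= 0: the disjoint union of C_m, P_l and C_n, with vertex 0 of C_m
   joined to the first vertex of P_l and the last vertex of P_l joined to
   vertex 0 of C_n; if l = 0, the vertices 0 of C_m and C_n are joined. *)
Definition dumbbell_rel (m l n : nat) : rel ('I_m + 'I_l + 'I_n) :=
  fun u v => match u, v with
  | inl (inl i), inl (inl j) => cycle_step m i j
  | inl (inr i), inl (inr j) => path_step i j
  | inr i, inr j => cycle_step n i j
  | inl (inl i), inl (inr j) => (i == 0 :> nat) && (j == 0 :> nat)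
  | inl (inr i), inr j => (i.+1 == l) && (j == 0 :> nat)
  | inl (inl i), inr j => [&& l == 0, i == 0 :> nat & j == 0 :> nat]
  | _, _ => false
  end%N.

(* C_m and C_n with their vertices 0 identified: the shared vertex is the
   vertex 0 of C_m, and only the other vertices of C_n are added. *)
Definition wedge_rel (m n : nat) :
    rel ('I_m + {j : 'I_n | j != 0 :> nat}%N) :=
  fun u v => match u, v with
  | inl i, inl j => cycle_step m i j
  | inr i, inr j => cycle_step n (val i) (val j)
  | inl i, inr j =>
      (i == 0 :> nat) && (cycle_step n 0 (val j) || cycle_step n (val j) 0)
  | _, _ => false
  end%N.

(* D(m,l,n) is only meant for l >= -1; the second case is l = -1. *)
Definition dumbbell_graph (m : nat) (l : int) (n : nat) : sgraph :=
  match l with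
  | Posz k => graph_of_rel (@dumbbell_rel m k n)
  | Negz _ => graph_of_rel (@wedge_rel m n)
  end.

Definition proper_colouring (G : sgraph) (k : {ffun G -> nat}) : Prop :=
  forall x y : G, sadj x y -> k x != k y.

(* The infinite sum over colourings is taken coefficientwise; by
   [finite_colourings] below, each coefficient is a finite sum. *)
Definition chromsym (G : sgraph) : fpseries := fun M =>
  \sum_(k \in [set k : {ffun G -> nat} | proper_colouring k])
    (\prod_(v : G) fpvar (k v)) M.

Lemma prod_fpvar (s : seq nat) (M : {mset nat}%mset) :
  (\prod_(i <- s) fpvar i) M = (M == seq_mset s)%:R.
Proof.
elim: s M => [|i s IHs] M.
  rewrite big_nil [LHS]/(fps_one M); congr (nat_of_bool (M == _))%:R.
  by apply/msetP => x; rewrite mset0E mset_seqE.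
rewrite big_cons [LHS](@fps_mulE _ _ M M) ?msubset_refl//.
have -> : seq_mset (i :: s) = ([mset i] `+` seq_mset s)%mset.
  by apply/msetP => x; rewrite msetE2 !mset_seqE msetnE /= eq_sym; case: eqP.
transitivity (\sum_(a <- submsets M) if [mset i]%mset == a then
   \sum_(b <- submsets M) if seq_mset s == b then
     (M == (a `+` b)%mset)%:R else 0 else 0 :> int).
  apply: eq_bigr => a _; rewrite /fpvar eq_sym.
  case: eqP => [<-|_]; last by rewrite big1// => b _; rewrite mul0r; case: ifP.
  apply: eq_bigr => b _; rewrite mul1r IHs [b == _]eq_sym [M == _]eq_sym.
  by case: eqP; case: eqP.
have [E|nE] := eqVneq M ([mset i] `+` seq_mset s)%mset.
  rewrite (big_submsets (fun a => \sum_(b <- submsets M)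
    if seq_mset s == b then (M == (a `+` b)%mset)%:R else 0)).
    by rewrite big_submsets ?E ?msubset_addr ?eqxx.
  by rewrite E msubset_addl.
rewrite big1// => a _; case: eqP => // <-; rewrite big1// => b _.
by case: eqP => // <-; rewrite (negPf nE).
Qed.

Lemma finite_colourings (G : sgraph) (M : {mset nat}%mset) :
  finite_set [set k : {ffun G -> nat}
    | proper_colouring k /\ (\prod_(v : G) fpvar (k v)) M != 0].
Proof.
pose F (c : {ffun G -> seq_sub (M : seq nat)}) : {ffun G -> nat} :=
  [ffun v => val (c v)].
apply: (@sub_finite_set _ _ (F @` setT)); last exact/finite_image/finite_finset.
move=> k [_]; rewrite -(big_map k xpredT fpvar) prod_fpvar.
case: (M =P _) => [ME _|_ /eqP//].
have kM v : k v \in (M : seq nat).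
  by rewrite ME (perm_mem (perm_eq_seq_mset _)) map_f ?mem_index_enum.
exists [ffun v => SeqSub (kM v)] => //.
by apply/ffunP => v; rewrite !ffunE.
Qed.

(* Main.v *)
From HB Require Import structures.
Require Import Defs.
From mathcomp Require Import all_boot all_order all_algebra.
From mathcomp Require Import finmap multiset ring zify.
From mathcomp Require Import boolp classical_sets fsbigop.
Set Implicit Arguments.
Unset Strict Implicit.
Unset Printing Implicit Defensive.
Import GRing.Theory Num.Theory.
Local Open Scope ring_scope.

(** The identity comes from a rooted identity that can be applied to each of
    the two cycles separately.

    Only finitely many colours: killing the variables x_c with c >= N is a ring
    morphism ([truncate]), a series is determined by its truncations
    ([eq_truncate]), and the truncation of X_G is the finite sum of the
    monomials of the proper colourings with N colours ([truncate_chromsym]).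
    So it suffices to work in a commutative ring with a finite palette C and a
    weight x_c for each colour c.

    Let [step] be the operator (T f)(a) = sum_(c <> a) x_c f(c), so that T^k
    sums over the ways to colour a path of k vertices appended to a vertex of
    colour a. Put w_k = T^k 1 ([walks]), and let z_n(a) ([returns]) be the sum
    over the colourings of the n-1 other vertices of a cycle C_n through a
    vertex of colour a. Write P_k and C_n for the finite versions of X_(P_k)
    and X_(C_n), and <f, g> for the sum of x_a f(a) g(a), for which T is
    symmetric. Then <w_i, w_j> = P_(i+j+1), C_n = <1, z_n> for n >= 2, and
    X_(D(m,l,n)) becomes <z_m, T^(l+1) z_n>, also for l = -1: the graph is read
    off as two cycles joined by l+1 edges.

    The heart is the identity, valid for every single colour a ([returnsE]),
      z_(n+1)(a) = n w_n(a) - sum_(2 <= i <= n) C_i w_(n-i)(a),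
    which replaces a cycle attached at a vertex by pendant paths and disjoint
    cycles. It is proved by induction on n from two remarks. A walk of n steps
    from a ends or does not end at a, so w_n = z_(n+1) + x_a z_n. And
    T f = <1, f> - x f gives w_(k+1) = P_(k+1) - x_a w_k. The error term left by
    these recurrences is n P_(n+1) - sum_i C_i P_(n+1-i), and it vanishes
    because summing x_a times the identity for n over a is exactly that
    relation. Substituting the identity for z_n and then for z_m in
    <z_m, T^(l+1) z_n> yields the four terms of the theorem
    ([dumbbell_sumE]). *)

(** * Walks on a weighted palette *)

Section Walks.
Variables (A : comNzRingType) (C : finType) (x : C -> A).

Definition step (f : C -> A) (a : C) : A := \sum_(c | a != c) x c * f c.

Definition pairing (f g : C -> A) : A := \sum_a x a * f a * g a.

Definition walks (k : nat) : C -> A := iter k step (fun=> 1).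
Arguments walks : simpl never.

(** For n >= 1, the colourings of the vertices other than the root of a rooted
    cycle with n vertices: a path of n-1 vertices whose last colour also
    differs from that of the root. For n = 1 it is 0, as for a loop. *)
Definition returns (n : nat) (a : C) : A :=
  iter n.-1 step (fun b => (b != a)%:R) a.

Definition path_sum (k : nat) : A :=
  if k is k'.+1 then \sum_a x a * walks k' a else 1.

Definition cycle_sum (n : nat) : A := \sum_a x a * returns n a.

Lemma stepE f a : step f a = \sum_c x c * f c - x a * f a.
Proof.
rewrite (bigD1 a)//= addrC addrK.
by apply: eq_bigl => c; rewrite eq_sym.
Qed.

Lemma eq_iter_step k f g : f =1 g -> iter k step f =1 iter k step g.
Proof.
move=> fg; elim: k => //= k IHk a.
by apply: eq_bigr => c _; rewrite IHk.
Qed.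

Lemma iter_stepD k f g a :
  iter k step (fun b => f b + g b) a = iter k step f a + iter k step g a.
Proof.
elim: k a => //= k IHk a; rewrite -big_split.
by apply: eq_bigr => c _; rewrite IHk mulrDr.
Qed.

Lemma iter_stepZ k y f a :
  iter k step (fun b => y * f b) a = y * iter k step f a.
Proof.
elim: k a => //= k IHk a; rewrite /step mulr_sumr.
by apply: eq_bigr => c _; rewrite IHk mulrCA.
Qed.

Lemma pairingC f g : pairing f g = pairing g f.
Proof. by apply: eq_bigr => a _; ring. Qed.

(** The matrix x_a [a <> c] x_c of this bilinear form is symmetric. *)
Lemma pairing_step f g : pairing f (step g) = pairing (step f) g.
Proof.
transitivity (\sum_a \sum_c x a * f a * (x c * g c)
    - \sum_a x a * f a * (x a * g a)).
  rewrite -sumrB; apply: eq_bigr => a _.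
  by rewrite stepE mulrBr mulr_sumr.
rewrite exchange_big -sumrB; apply: eq_bigr => a _ /=.
by rewrite stepE mulrBr mulrBl mulr_sumr mulr_suml; congr (_ - _);
  [apply: eq_bigr => c _|]; ring.
Qed.

Lemma pairing_iter_step k f g :
  pairing f (iter k step g) = pairing (iter k step f) g.
Proof. by elim: k f => //= k IHk f; rewrite pairing_step IHk -iterS iterSr. Qed.

Lemma pairing_walks i j : pairing (walks i) (walks j) = path_sum (i + j).+1.
Proof.
rewrite -pairing_iter_step -iterD.
by apply: eq_bigr => a _; rewrite mulr1.
Qed.

(** Append a vertex unconstrained by its neighbour of colour a, and discard the
    colourings giving it the colour a. *)
Lemma walksS k a : walks k.+1 a = path_sum k.+1 - x a * walks k a.
Proof. exact: stepE. Qed.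

(** The walks from a are split according to whether their last colour is a;
    those ending at a are closed walks one step shorter, times x_a. *)
Lemma walks_returns n a :
  walks n.+1 a = returns n.+2 a + x a * returns n.+1 a.
Proof.
rewrite /returns ![_.-1]/= -iter_stepZ.
(* both sides count walks ending at a: its last step contributes x_a when the
   previous colour is not a *)
have -> : iter n step (fun b => x a * (b != a)%:R) a =
          iter n.+1 step (fun b => (b == a)%:R) a.
  rewrite iterSr; apply: eq_iter_step => b; rewrite /step eq_sym.
  case: (eqVneq a b) => [<-|ab].
    by rewrite mulr0 big1// => c; rewrite eq_sym => /negPf ->; rewrite mulr0.
  rewrite (bigD1 a) 1?eq_sym//= eqxx mulr1 big1 ?addr0 ?mulr1//.
  by move=> c /andP[_ /negPf ->]; rewrite mulr0.
rewrite -iter_stepD; apply: eq_iter_step => b.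
by case: eqP; rewrite ?addr0 ?add0r.
Qed.

(** The rooted identity: the cycle through a vertex of colour a is traded for
    pendant paths and disjoint cycles. *)
Lemma returnsE n a :
  returns n.+1 a = n%:R * walks n a
    - \sum_(2 <= i < n.+1) cycle_sum i * walks (n - i) a.
Proof.
elim: n a => [|n IHn] a.
  by rewrite /returns /= eqxx big_geq// mul0r subr0.
(* the induction hypothesis, weighted by x_a and summed over a *)
have path_cycle : n%:R * path_sum n.+1 =
    \sum_(2 <= i < n.+1) cycle_sum i * path_sum (n.+1 - i) + cycle_sum n.+1.
  rewrite [cycle_sum n.+1](eq_bigr (fun b => n%:R * (x b * walks n b)
    - \sum_(2 <= i < n.+1) cycle_sum i * (x b * walks (n - i) b))); last first.
    move=> b _; rewrite IHn mulrBr mulr_sumr; congr (_ - _); first by ring.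
    by apply: eq_bigr => i _; ring.
  rewrite sumrB -mulr_sumr exchange_big /= addrC.
  rewrite [X in _ - X + _](_ : _ =
    \sum_(2 <= i < n.+1) cycle_sum i * path_sum (n.+1 - i)) ?subrK//.
  rewrite !big_nat; apply: eq_bigr => i /andP[_ lin].
  by rewrite -mulr_sumr subSn.
(* n.+2 enters through walks n.+1 = returns n.+2 + x_a returns n.+1 *)
apply: (addIr (x a * returns n.+1 a)); rewrite -walks_returns IHn.
rewrite mulrBr [X in _ + (_ - X)]mulr_sumr.
case: n {IHn} path_cycle => [|n] path_cycle.
  by rewrite !big_geq//; ring.
rewrite [X in _ = _ - X + _]big_nat_recr//= subnn mulr1.
rewrite [X in _ - (X + _) + _](_ : _ =
   \sum_(2 <= i < n.+2) cycle_sum i * path_sum (n.+2 - i)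
   - \sum_(2 <= i < n.+2) x a * (cycle_sum i * walks (n.+1 - i) a)); last first.
  rewrite -sumrB !big_nat; apply: eq_bigr => i /andP[_ lin].
  by rewrite subSn// walksS; ring.
have -> : \sum_(2 <= i < n.+2) cycle_sum i * path_sum (n.+2 - i) =
    n.+1%:R * path_sum n.+2 - cycle_sum n.+2 by rewrite path_cycle addrK.
by rewrite walksS; ring.
Qed.

(** Summed over the colour of the root, the rooted identity applies to any
    rooted graph, whose colourings f sums according to the root's colour. *)
Lemma pairing_returns f n :
  pairing f (returns n.+1) = n%:R * pairing f (walks n)
    - \sum_(2 <= i < n.+1) pairing f (walks (n - i)) * cycle_sum i.
Proof.
transitivity (\sum_a (n%:R * (x a * f a * walks n a)
    - \sum_(2 <= i < n.+1) x a * f a * walks (n - i) a * cycle_sum i)).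
  apply: eq_bigr => a _; rewrite returnsE mulrBr mulr_sumr.
  by congr (_ - _); [|apply: eq_bigr => i _]; ring.
rewrite sumrB -mulr_sumr exchange_big /=; congr (_ - _).
by apply: eq_bigr => i _; rewrite mulr_suml.
Qed.

Lemma pairing_returns_walks m k :
  pairing (returns m.+1) (walks k) = m%:R * path_sum (m + k).+1
    - \sum_(2 <= j < m.+1) path_sum (m + k - j).+1 * cycle_sum j.
Proof.
rewrite pairingC pairing_returns pairing_walks addnC; congr (_ - _).
rewrite !big_nat; apply: eq_bigr => j /andP[_ ltjm].
by rewrite pairing_walks addnBA// addnC.
Qed.

(** Symmetry of [step] lets the p connecting steps be absorbed on either side,
    so that each of the two cycles can be expanded in turn. *)
Lemma dumbbell_sumE m p n :
  pairing (returns m.+1) (iter p step (returns n.+1)) =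
    m%:R * n%:R * path_sum (m + p + n).+1
    - m%:R * \sum_(2 <= i < n.+1) path_sum (m + p + n - i).+1 * cycle_sum i
    - n%:R * \sum_(2 <= j < m.+1) path_sum (m + p + n - j).+1 * cycle_sum j
    + \sum_(2 <= i < n.+1) \sum_(2 <= j < m.+1)
        path_sum (m + p + n - i - j).+1 * cycle_sum i * cycle_sum j.
Proof.
rewrite pairing_iter_step pairing_returns.
rewrite -pairing_iter_step -iterD -/(walks _) pairing_returns_walks addnA.
rewrite [X in _ - X](_ : _ = m%:R *
      (\sum_(2 <= i < n.+1) path_sum (m + p + n - i).+1 * cycle_sum i)
   - \sum_(2 <= i < n.+1) \sum_(2 <= j < m.+1)
        path_sum (m + p + n - i - j).+1 * cycle_sum i * cycle_sum j).
  by ring.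
rewrite mulr_sumr -sumrB !big_nat; apply: eq_bigr => i /andP[_ ltin].
rewrite -pairing_iter_step -iterD -/(walks _) pairing_returns_walks.
rewrite addnA addnBA// mulrBl mulrA mulr_suml; congr (_ - _).
by apply: eq_bigr => j _; ring.
Qed.
End Walks.
(** * Sums over words *)

Section Words.
Variables (A : comNzRingType) (C : finType) (x : C -> A).

(** Sums over the words of length n, as iterated sums over the letters, so that
    words split and compute without casts between tuple types. *)
Fixpoint word_sum (n : nat) (F : seq C -> A) : A :=
  if n is n'.+1 then \sum_c word_sum n' (fun s => F (c :: s)) else F [::].

Lemma eq_word_sum n F G :
  (forall s, size s = n -> F s = G s) -> word_sum n F = word_sum n G.
Proof.
elim: n F G => [|n IHn] F G FG /=; first exact: FG.
by apply: eq_bigr => c _; apply: IHn => s sz; apply: FG; rewrite /= sz.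
Qed.

Lemma word_sum_mulr n y F : word_sum n (fun s => y * F s) = y * word_sum n F.
Proof.
by elim: n F => //= n IHn F; rewrite mulr_sumr; apply: eq_bigr => c _.
Qed.

Lemma word_sum_cat m n F :
  word_sum (m + n) F = word_sum m (fun s => word_sum n (fun t => F (s ++ t))).
Proof.
by elim: m F => //= m IHm F; apply: eq_bigr => c _; rewrite IHm.
Qed.

Lemma word_sum_tuple n F : word_sum n F = \sum_(t : n.-tuple C) F t.
Proof.
elim: n F => [|n IHn] F.
  by rewrite (big_pred1 [tuple])// => t; apply/esym/eqP/tuple0.
rewrite /= (eq_bigr _ (fun c _ => IHn _)) pair_big /=.
rewrite (reindex (fun p : C * n.-tuple C => [tuple of p.1 :: p.2])) //=.
exists (fun t : n.+1.-tuple C => (thead t, [tuple of behead t])) => /=.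
  by move=> [c t] _; congr pair; apply/val_inj.
by move=> t _; rewrite /= -tuple_eta.
Qed.

(** Listing the vertices turns colourings into words. *)
Lemma colourings_word_sum (V : finType) (s : seq V) F :
    uniq s -> (forall v, v \in s) ->
  \sum_(k : {ffun V -> C}) F [seq k v | v <- s] = word_sum (size s) F.
Proof.
move=> us fs; rewrite word_sum_tuple.
rewrite [RHS](reindex (fun k : {ffun V -> C} => map_tuple k (in_tuple s)))//=.
apply/onW_bij/inj_card_bij => [k k' /(congr1 val)/= /eq_in_map kk'|].
  by apply/ffunP => v; apply: kk'.
rewrite card_tuple card_ffun [#|V|]cardT.
suff /perm_size -> : perm_eq s (enum V) by [].
by apply: uniq_perm; rewrite ?enum_uniq// => v; rewrite fs mem_enum.
Qed.

Local Notation neq := (fun a b : C => a != b).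

Definition weight (s : seq C) : A := \prod_(c <- s) x c.

Lemma weight_cons c s : weight (c :: s) = x c * weight s.
Proof. exact: big_cons. Qed.

Lemma weight_cat s t : weight (s ++ t) = weight s * weight t.
Proof. exact: big_cat. Qed.

(** Iterating [step] is the transfer-matrix form of a sum over properly coloured
    paths. *)
Lemma word_sum_walk n a f :
  word_sum n (fun s => (path neq a s)%:R * weight s * f (last a s)) =
  iter n (step x) f a.
Proof.
elim: n a => [|n IHn] a /=; first by rewrite /weight big_nil !mul1r.
rewrite /step [RHS]big_mkcond; apply: eq_bigr => c _.
case: ifP => _; last first.
  rewrite -(mul0r (word_sum n (fun=> 0))) -word_sum_mulr.
  by apply: eq_word_sum => s _; rewrite !mul0r.
rewrite -IHn -word_sum_mulr; apply: eq_word_sum => s _.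
by rewrite weight_cons; ring.
Qed.

Lemma word_sum_path n :
  word_sum n (fun s => (sorted neq s)%:R * weight s) = path_sum x n.
Proof.
case: n => [|n] /=; first by rewrite /weight big_nil mulr1.
apply: eq_bigr => a _; rewrite /walks -word_sum_walk -word_sum_mulr.
by apply: eq_word_sum => s _; rewrite weight_cons; ring.
Qed.

Lemma word_sum_loop n a :
  word_sum n (fun s => (cycle neq (a :: s))%:R * weight s) =
  returns x n.+1 a.
Proof.
rewrite /returns -word_sum_walk; apply: eq_word_sum => s _ /=.
by rewrite rcons_path -mulnb natrM; ring.
Qed.

Lemma word_sum_cycle n :
  word_sum n.+1 (fun s => (cycle neq s)%:R * weight s) = cycle_sum x n.+1.
Proof.
apply: eq_bigr => a _; rewrite -word_sum_loop -word_sum_mulr.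
by apply: eq_word_sum => s _; rewrite weight_cons; ring.
Qed.

(** The proper words for the dumbbell whose vertices are listed as those of the
    first cycle, of the path, and of the second cycle, each cycle starting at
    its attaching vertex. *)
Definition dumbbell_word (m l : nat) (s : seq C) : bool :=
  let s1 := take m s in let s2 := take l (drop m s) in
  let s3 := drop l (drop m s) in
  [&& cycle neq s1, sorted neq (take 1 s1 ++ s2 ++ take 1 s3) & cycle neq s3].

Lemma word_sum_dumbbell m l n :
  word_sum (m.+1 + (l + n.+1))
    (fun s => (dumbbell_word m.+1 l s)%:R * weight s) =
  pairing x (returns x m.+1) (iter l.+1 (step x) (returns x n.+1)).
Proof.
rewrite word_sum_cat; apply: eq_bigr => a _.
rewrite -word_sum_loop mulrAC -word_sum_mulr.
rewrite -/(word_sum m _); apply: eq_word_sum => s1 sz1.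
rewrite word_sum_cat iterSr -word_sum_walk mulrAC -word_sum_mulr.
apply: eq_word_sum => s2 sz2.
rewrite /step big_mkcond 2!mulr_sumr; apply: eq_bigr => b _.
rewrite -word_sum_loop.
transitivity ((x a * ((cycle neq (a :: s1))%:R * weight s1) *
  ((path neq a s2)%:R * weight s2 * ((last a s2 != b)%:R * x b))) *
  word_sum n (fun s3 => (cycle neq (b :: s3))%:R * weight s3)); last first.
  by case: ifP => _; rewrite ?mulr1n ?mulr0n; ring.
rewrite -word_sum_mulr; apply: eq_word_sum => s3 _.
have -> : dumbbell_word m.+1 l ((a :: s1) ++ s2 ++ b :: s3) =
  [&& cycle neq (a :: s1), path neq a s2, last a s2 != b
    & cycle neq (b :: s3)].
  rewrite /dumbbell_word take_size_cat /= ?sz1// drop_size_cat//.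
  rewrite take_size_cat// drop_size_cat//=.
  by rewrite !take0 cat0s cats1 !rcons_path -!andbA.
by rewrite !weight_cat !weight_cons -!mulnb !natrM; ring.
Qed.

(** Here the shared vertex is listed only once, at the head of the word. *)
Definition wedge_word (m : nat) (s : seq C) : bool :=
  cycle neq (take m s) && cycle neq (take 1 s ++ drop m s).

Lemma word_sum_wedge m n :
  word_sum (m.+1 + n) (fun s => (wedge_word m.+1 s)%:R * weight s) =
  pairing x (returns x m.+1) (returns x n.+1).
Proof.
rewrite word_sum_cat; apply: eq_bigr => a _.
rewrite -word_sum_loop mulrAC -word_sum_mulr.
rewrite -/(word_sum m _); apply: eq_word_sum => s1 sz1.
rewrite -word_sum_loop mulrAC -word_sum_mulr.
apply: eq_word_sum => s2 sz2.
rewrite /wedge_word drop_size_cat /= ?sz1// take_size_cat// take0.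
by rewrite !weight_cons weight_cat -!mulnb !natrM /=; ring.
Qed.
End Words.
(** * Proper colourings as words *)

Definition properb (G : sgraph) (T : eqType) (k : G -> T) : bool :=
  [forall u : G, forall v : G, sadj u v ==> (k u != k v)].

Definition colour_sum (A : comNzRingType) (C : finType) (x : C -> A)
    (G : sgraph) : A :=
  \sum_(k : {ffun G -> C} | properb k) \prod_(v : G) x (k v).

Section Graphs.
Variables (C : finType).
Local Notation neq := (fun a b : C => a != b).

Lemma proper_graph_of_relP (V : finType) (r : rel V) (k : V -> C) :
  reflect (forall u v, u != v -> r u v -> k u != k v)
          (properb (G := graph_of_rel r) k).
Proof.
apply: (iffP idP) => [/forallP pk u v uv ruv|pk].
  have /forallP/(_ v)/implyP := pk u; apply.
  by rewrite /= /simple_closure uv ruv.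
apply/forallP => u; apply/forallP => v; apply/implyP.
case/andP => uv /orP[ruv|rvu]; first exact: pk.
by rewrite eq_sym; apply: pk => //; rewrite eq_sym.
Qed.

Lemma sorted_enum_ordP n (e : rel 'I_n) :
  reflect (forall i j : 'I_n, path_step i j -> e i j) (sorted e (enum 'I_n)).
Proof.
case: n e => [|n] e.
  have -> : enum 'I_0 = [::] by apply/size0nil; rewrite size_enum_ord.
  by apply: ReflectT => -[].
apply: (iffP (sortedP ord0)) => [se i j /eqP ji|se i].
  have := se i; rewrite size_enum_ord -ji ltn_ord => /(_ isT).
  by rewrite !nth_ord_enum.
rewrite size_enum_ord => ltin; apply: se.
by rewrite /path_step !nth_enum_ord// ltnW.
Qed.

Lemma cycle_enum_ordP n (e : rel 'I_n) :
  reflect (forall i j : 'I_n, cycle_step n i j -> e i j) (cycle e (enum 'I_n)).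
Proof.
have nextE (i : 'I_n) : next (enum 'I_n) i = (i.+1 %% n)%N :> nat.
  case: n e i => [|n] _ i; first by case: i.
  rewrite next_nth mem_enum inE index_enum_ord enum_ordSl.
  have [ltin|] := ltnP i n; last first.
    move=> leni; have -> : nat_of_ord i = n.
      by apply/eqP; rewrite eqn_leq leni -ltnS ltn_ord.
    by rewrite modnn nth_default // size_map size_enum_ord.
  rewrite (nth_map (Ordinal ltin)) ?size_enum_ord// modn_small //=.
  by rewrite nth_enum_ord.
apply: (iffP idP) => [ce i j /eqP ji|ce].
  have -> : j = next (enum 'I_n) i by apply/val_inj; rewrite /= nextE.
  by apply: next_cycle; rewrite ?mem_enum.
apply: cycle_from_next; rewrite ?enum_uniq// => i _; apply: ce.
by rewrite /cycle_step nextE.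
Qed.

Lemma sorted_map_enum_ordP n (f : 'I_n -> C) :
  reflect (forall i j : 'I_n, path_step i j -> f i != f j)
          (sorted neq [seq f i | i <- enum 'I_n]).
Proof. by rewrite sorted_map; apply: sorted_enum_ordP. Qed.

Lemma cycle_map_enum_ordP n (f : 'I_n -> C) :
  reflect (forall i j : 'I_n, cycle_step n i j -> f i != f j)
          (cycle neq [seq f i | i <- enum 'I_n]).
Proof. by rewrite cycle_map; apply: cycle_enum_ordP. Qed.

Lemma cycle_step_neq n (i j : 'I_n) : (1 < n)%N -> cycle_step n i j -> i != j.
Proof.
move=> n1; apply: contraTneq => ->; rewrite /cycle_step.
have [ltjn|lenj] := ltnP j.+1 n; first by rewrite modn_small// ltn_eqF.
have -> : j.+1 = n by apply/eqP; rewrite eqn_leq lenj ltn_ord.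
by rewrite modnn -lt0n -ltnS (leq_trans n1).
Qed.

Lemma path_step_neq n (i j : 'I_n) : path_step i j -> i != j.
Proof. by apply: contraTneq => ->; rewrite /path_step ltn_eqF. Qed.
End Graphs.

Section GraphWords.
Variables (A : comNzRingType) (C : finType) (x : C -> A).
Local Notation neq := (fun a b : C => a != b).

Lemma colour_sum_words (G : sgraph) (s : seq G) (P : pred (seq C)) :
    uniq s -> (forall v, v \in s) ->
    (forall k : G -> C, properb k = P [seq k v | v <- s]) ->
  colour_sum x G = word_sum (size s) (fun t => (P t)%:R * weight x t).
Proof.
move=> us fs Pk.
rewrite -colourings_word_sum// /colour_sum big_mkcond /=.
apply: eq_bigr => k _; rewrite Pk.
have -> : weight x [seq k v | v <- s] = \prod_v x (k v).
  rewrite /weight big_map; apply: perm_big; apply: uniq_perm => //.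
    exact: index_enum_uniq.
  by move=> v; rewrite fs mem_index_enum.
by case: (P _); rewrite ?mul1r ?mul0r.
Qed.

Lemma colour_sum_path n : colour_sum x (path_graph n) = path_sum x n.
Proof.
rewrite -word_sum_path.
rewrite (@colour_sum_words (path_graph n) (enum 'I_n) (sorted neq)).
- by rewrite size_enum_ord.
- exact: enum_uniq.
- by move=> v; rewrite mem_enum.
move=> k.
apply/proper_graph_of_relP/sorted_map_enum_ordP => pk i j.
  by move=> ij; apply: pk; rewrite // path_step_neq.
by move=> _; apply: pk.
Qed.

Lemma colour_sum_cycle n :
  (1 < n)%N -> colour_sum x (cycle_graph n) = cycle_sum x n.
Proof.
case: n => // n n1; rewrite -word_sum_cycle.
rewrite (@colour_sum_words (cycle_graph n.+1) (enum 'I_n.+1) (cycle neq)).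
- by rewrite size_enum_ord.
- exact: enum_uniq.
- by move=> v; rewrite mem_enum.
move=> k.
apply/proper_graph_of_relP/cycle_map_enum_ordP => pk i j.
  by move=> ij; apply: pk; rewrite // (cycle_step_neq n1).
by move=> _; apply: pk.
Qed.

(** A path whose two ends are joined to further vertices of colours a and b,
    which are adjacent to each other when the path is empty. *)
Lemma path_map_enum_ordP l (f : 'I_l -> C) a b :
  reflect [/\ forall i j : 'I_l, path_step i j -> f i != f j,
              forall j : 'I_l, j = 0%N :> nat -> a != f j,
              forall i : 'I_l, i.+1 = l -> f i != b
            & l = 0%N -> a != b]
          (path neq a (rcons [seq f i | i <- enum 'I_l] b)).
Proof.
case: l f => [|l] f.
  have -> : enum 'I_0 = [::] by apply/size0nil; rewrite size_enum_ord.
  rewrite /= andbT; apply: (iffP idP) => [ab|[_ _ _]]; last exact.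
  by split => // -[].
rewrite rcons_path {2}enum_ordSr map_rcons last_rcons.
have -> : path neq a [seq f i | i <- enum 'I_l.+1] =
    (a != f ord0) && sorted neq [seq f i | i <- enum 'I_l.+1].
  by rewrite enum_ordSl.
rewrite -andbA; apply: (iffP and3P) => [[af0 /sorted_map_enum_ordP fs fb]|].
  split => // [j j0|i [il]].
    by have -> : j = ord0 by apply/val_inj.
  by have -> : i = ord_max by apply/val_inj.
case=> fs af fb _; split; [exact: af|exact/sorted_map_enum_ordP|exact: fb].
Qed.

(** The l+1 edges leading from one attaching vertex to the other give the
    l+1 steps between the two families of closed walks. *)
Lemma colour_sum_dumbbell m l n : (1 < m.+1)%N -> (1 < n.+1)%N ->
  colour_sum x (dumbbell_graph m.+1 (Posz l) n.+1) =
  pairing x (returns x m.+1) (iter l.+1 (step x) (returns x n.+1)).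
Proof.
move=> m1 n1; rewrite -word_sum_dumbbell.
pose V : finType := ('I_m.+1 + 'I_l + 'I_n.+1)%type.
pose f1 (i : 'I_m.+1) : V := inl (inl i).
pose f2 (i : 'I_l) : V := inl (inr i).
pose f3 (i : 'I_n.+1) : V := inr i.
pose s1 := map f1 (enum 'I_m.+1).
pose s2 := map f2 (enum 'I_l).
pose s3 := map f3 (enum 'I_n.+1).
have sz1 : size s1 = m.+1 by rewrite size_map size_enum_ord.
have sz2 : size s2 = l by rewrite size_map size_enum_ord.
have sz3 : size s3 = n.+1 by rewrite size_map size_enum_ord.
have u1 : uniq s1 by rewrite map_inj_uniq ?enum_uniq// => i j [].
have u2 : uniq s2 by rewrite map_inj_uniq ?enum_uniq// => i j [].
have u3 : uniq s3 by rewrite map_inj_uniq ?enum_uniq// => i j [].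
have <- : size (s1 ++ s2 ++ s3) = (m.+1 + (l + n.+1))%N.
  by rewrite !size_cat sz1 sz2 sz3.
apply: (@colour_sum_words (dumbbell_graph m.+1 (Posz l) n.+1)) => [||k].
- rewrite !cat_uniq u1 u2 u3 /= andbT; apply/andP; split; apply/hasPn => v.
    by rewrite mem_cat => /orP[] /mapP[i _ ->]; apply/mapP => -[].
  by move=> /mapP[i _ ->]; apply/mapP => -[].
- move=> [[i|i]|i]; rewrite !mem_cat; apply/or3P;
    by [apply: Or31; apply/map_f; rewrite mem_enum
       |apply: Or32; apply/map_f; rewrite mem_enum
       |apply: Or33; apply/map_f; rewrite mem_enum].
rewrite /dumbbell_word !map_cat take_size_cat ?(size_map k)//.
rewrite drop_size_cat ?(size_map k)//.
rewrite take_size_cat ?(size_map k)//.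
rewrite drop_size_cat ?(size_map k)//.
rewrite /s1 /s2 /s3 -!(map_comp k).
have -> : sorted neq (take 1 (map (k \o f1) (enum 'I_m.+1)) ++
    map (k \o f2) (enum 'I_l) ++ take 1 (map (k \o f3) (enum 'I_n.+1))) =
  path neq (k (f1 ord0)) (rcons (map (k \o f2) (enum 'I_l)) (k (f3 ord0))).
  by rewrite !enum_ordSl /= !take0 cats1.
apply/proper_graph_of_relP/and3P => [pk|[/cycle_map_enum_ordP p1
  /path_map_enum_ordP[p2 p12 p23 p13] /cycle_map_enum_ordP p3]].
  split.
  - apply/cycle_map_enum_ordP => i j ij; apply: pk => //.
    exact: (cycle_step_neq m1).
  - apply/path_map_enum_ordP; split => [i j ij|j j0|i il|l0]; apply: pk => //=.
    + exact: path_step_neq.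
    + by rewrite j0.
    + by rewrite il eqxx.
    + by rewrite l0.
  - apply/cycle_map_enum_ordP => i j ij; apply: pk => //.
    exact: (cycle_step_neq n1).
have ord0E p (i : 'I_p.+1) : i = 0%N :> nat -> i = ord0.
  by move=> i0; apply/val_inj.
move=> [[i|i]|i] [[j|j]|j] // _ /=.
- exact: p1.
- by move=> /andP[/eqP/ord0E-> /eqP]; apply: p12.
- by move=> /and3P[/eqP l0 /eqP/ord0E-> /eqP/ord0E->]; apply: p13.
- exact: p2.
- by move=> /andP[/eqP il /eqP/ord0E->]; apply: p23.
- exact: p3.
Qed.

Lemma colour_sum_wedge m p n : (1 < m.+1)%N -> (1 < n.+1)%N ->
  colour_sum x (dumbbell_graph m.+1 (Negz p) n.+1) =
  pairing x (returns x m.+1) (returns x n.+1).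
Proof.
move=> m1 n1; rewrite -word_sum_wedge.
pose W := {j : 'I_n.+1 | j != 0 :> nat}%N.
pose V : finType := ('I_m.+1 + W)%type.
pose w (i : 'I_n) : W := Sub (lift ord0 i) isT.
pose f1 (i : 'I_m.+1) : V := inl i.
pose f2 (i : 'I_n) : V := inr (w i).
pose s1 := map f1 (enum 'I_m.+1).
pose s2 := map f2 (enum 'I_n).
have wK (j : W) : exists i, j = w i.
  case: j => -[[|j] ltjn] j0 //.
  by exists (Ordinal (ltjn : (j < n)%N)); apply/val_inj/val_inj.
have w_inj : injective w by move=> i j /(congr1 val)/lift_inj.
have sz1 : size s1 = m.+1 by rewrite size_map size_enum_ord.
have sz2 : size s2 = n by rewrite size_map size_enum_ord.
have u1 : uniq s1 by rewrite map_inj_uniq ?enum_uniq// => i j [].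
have u2 : uniq s2.
  rewrite map_inj_uniq ?enum_uniq// => i j.
  by move=> /(congr1 (fun v : V => if v is inr j' then j' else w i))/w_inj.
have <- : size (s1 ++ s2) = (m.+1 + n)%N by rewrite size_cat sz1 sz2.
apply: (@colour_sum_words (dumbbell_graph m.+1 (Negz p) n.+1)) => [||k].
- rewrite cat_uniq u1 u2 andbT; apply/hasPn => v.
  by move=> /mapP[i _ ->]; apply/mapP => -[].
- move=> [i|j]; rewrite mem_cat; apply/orP; [left|right].
    by apply/map_f; rewrite mem_enum.
  by have [i ->] := wK j; apply/mapP; exists i; rewrite ?mem_enum.
rewrite /wedge_word !map_cat take_size_cat ?(size_map k)//.
rewrite drop_size_cat ?(size_map k)//.
rewrite /s1 /s2 -!(map_comp k).
(* the colouring of the whole second cycle, shared vertex included *)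
pose f (j : 'I_n.+1) : C :=
  if unlift ord0 j is Some i then k (inr (w i)) else k (inl ord0).
have -> : take 1 (map (k \o f1) (enum 'I_m.+1) ++ map (k \o f2) (enum 'I_n)) ++
    map (k \o f2) (enum 'I_n) =
    [seq f j | j <- enum 'I_n.+1].
  rewrite !enum_ordSl /= take0 /f unlift_none -map_comp; congr cons.
  by apply: eq_map => i /=; rewrite liftK.
have f0 (j : 'I_n.+1) : j = 0%N :> nat -> f j = k (inl ord0).
  by move=> j0; rewrite (_ : j = ord0) ?/f ?unlift_none //; apply/val_inj.
have fw (j : W) : f (val j) = k (inr j).
  by have [i ->] := wK j; rewrite /f /= liftK.
apply/proper_graph_of_relP/andP => [pk|
  [/cycle_map_enum_ordP p1 /cycle_map_enum_ordP p2]].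
  split; apply/cycle_map_enum_ordP => i j ij.
    by apply: pk => //; apply: (cycle_step_neq m1).
  have := cycle_step_neq n1 ij.
  have [i0|i0] := eqVneq (i : nat) 0%N; have [j0|j0] := eqVneq (j : nat) 0%N.
  - by rewrite -val_eqE /= i0 j0.
  - rewrite f0// -[j]/(val (Sub j j0 : W)) fw => _; apply: pk => //=.
    by move: ij; rewrite /cycle_step i0 => ->.
  - rewrite (f0 j)// => _; rewrite eq_sym -[i]/(val (Sub i i0 : W)) fw.
    apply: pk => //=.
    by move: ij; rewrite /cycle_step j0 => ->; rewrite orbT.
  - rewrite -[i]/(val (Sub i i0 : W)) -[j]/(val (Sub j j0 : W)) !fw => ij'.
    by apply: pk.
move=> [i|i] [j|j] // _ /=.
- exact: p1.
- move=> /andP[/eqP i0]; have -> : i = ord0 by apply/val_inj.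
  rewrite -fw -(f0 ord0)// => /orP[|].
    exact: (p2 ord0 (val j)).
  by rewrite eq_sym; apply: (p2 (val j) ord0).
- by rewrite -!fw; apply: p2.
Qed.
End GraphWords.

(** * Truncation to finitely many colours *)

Section Truncation.
Variable N : nat.

Definition small (M : {mset nat}%mset) : bool :=
  all (fun i => (i < N)%N) (M : seq nat).

(** The substitution x_i = 0 for i >= N, on coefficients. *)
Definition truncate (f : fpseries) : fpseries :=
  fun M => if small M then f M else 0.

Lemma small_msetD (a b : {mset nat}%mset) :
  small (a `+` b)%mset = small a && small b.
Proof.
apply/allP/andP => [sab|[/allP sa /allP sb] i]; last first.
  by rewrite in_msetD => /orP[/sa|/sb].
by split; apply/allP => i ii; apply: sab; rewrite in_msetD ii ?orbT.
Qed.

Lemma truncate_is_zmod_morphism : zmod_morphism truncate.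
Proof.
move=> f g; apply/funext => M.
rewrite /truncate [RHS]/GRing.add /= [X in _ = _ + X]/GRing.opp /=.
by case: ifP; rewrite ?subr0.
Qed.

(** A product of monomials uses only the first N variables if and only if both
    factors do. *)
Lemma truncate_is_monoid_morphism : monoid_morphism truncate.
Proof.
split; [|move=> f g]; apply/funext => M.
  rewrite /truncate [1 in LHS]/GRing.one [RHS]/GRing.one /= /fps_one.
  case: ifP => //; case: eqP => // ->.
  by rewrite /small enum_mset0.
rewrite [RHS]/GRing.mul /= /truncate [(f * g) M]/GRing.mul /=.
rewrite !(@fps_mulE _ _ M M) ?msubset_refl//.
transitivity (\sum_(a <- submsets M) \sum_(b <- submsets M)
   if small M then if (a `+` b)%mset == M then f a * g b else 0 else 0).
  by case: ifP => // _; rewrite big1// => a _; rewrite big1.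
apply: eq_bigr => a _; apply: eq_bigr => b _.
case: eqP => [<-|_]; last by case: ifP.
rewrite small_msetD; case: (small a) => /=; rewrite ?mul0r//.
by case: ifP; rewrite ?mulr0.
Qed.

HB.instance Definition _ :=
  GRing.isZmodMorphism.Build fpseries fpseries truncate
    truncate_is_zmod_morphism.
HB.instance Definition _ :=
  GRing.isMonoidMorphism.Build fpseries fpseries truncate
    truncate_is_monoid_morphism.

Lemma fps_sumE I (r : seq I) (P : pred I) (F : I -> fpseries) M :
  (\sum_(i <- r | P i) F i) M = \sum_(i <- r | P i) F i M.
Proof. by elim/big_rec2: _ => //= i _ f _ <-. Qed.

(** The right-hand side multiplies in the ring of series itself instead of in
    its bundled form as an abstract commutative ring; coefficients are extracted
    from it more directly. *)
Lemma fps_colour_sumE (x : 'I_N -> fpseries) (G : sgraph) :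
  colour_sum x G =
  \sum_(k : {ffun G -> 'I_N} | properb k) \prod_(v : G) x (k v).
Proof. by []. Qed.

(** A monomial in the first N variables only arises from colourings with values
    below N, and these produce no other monomials. *)
Lemma truncate_chromsym (G : sgraph) :
  truncate (chromsym G) = colour_sum (fun c : 'I_N => fpvar c) G.
Proof.
apply/funext => M; rewrite fps_colour_sumE fps_sumE /truncate /chromsym.
have prodE (k : {ffun G -> nat}) : (\prod_(v : G) fpvar (k v)) M =
    (M == seq_mset [seq k v | v <- index_enum G])%:R.
  by rewrite -prod_fpvar big_map.
have [lower lowerE] : {lower : {ffun G -> 'I_N} -> {ffun G -> nat} |
    forall k v, lower k v = k v}.
  by exists (fun k => [ffun v => val (k v)]) => k v; rewrite ffunE.
have prod_lower (k : {ffun G -> 'I_N}) :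
    \prod_(v : G) fpvar (k v) = \prod_(v : G) fpvar (lower k v).
  by apply: eq_bigr => v _; rewrite lowerE.
rewrite [RHS](eq_bigr (fun k => (\prod_(v : G) fpvar (lower k v)) M)); last first.
  by move=> k _; exact: (congr1 (fun f : fpseries => f M) (prod_lower k)).
case: ifP => [sM|/negP nsM]; last first.
  rewrite big1// => k _; rewrite prodE; case: eqP => // ME.
  case: nsM; apply/allP => i; rewrite ME (perm_mem (perm_eq_seq_mset _)).
  by case/mapP => v _ ->; rewrite lowerE.
have lower_inj : injective lower.
  by move=> k k' kk'; apply/ffunP => v; apply/val_inj; rewrite /= -!lowerE kk'.
pose r := [seq lower k | k <- enum [pred k : {ffun G -> 'I_N} | properb k]].
have rproper k : k \in r -> proper_colouring k.
  move=> /mapP[c + ->]; rewrite mem_enum => /forallP pc u v uv.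
  by rewrite !lowerE; have /forallP/(_ v)/implyP/(_ uv) := pc u.
rewrite (@fsbigE _ _ _ _ _ r) ?map_inj_uniq ?enum_uniq//.
  rewrite big_seq_cond (eq_bigl (fun k => k \in r)) => [|k]; last first.
    by apply: andb_idr => /rproper pk; rewrite inE.
  by rewrite -big_seq big_map big_enum.
move=> k pk; apply: contraNeq; rewrite prodE; case: (M =P _) => // ME _.
have kN v : (k v < N)%N.
  move/allP: sM; apply; rewrite ME (perm_mem (perm_eq_seq_mset _)).
  by rewrite map_f ?mem_index_enum.
have kE : k = lower [ffun v => Ordinal (kN v)].
  by apply/ffunP => v; rewrite lowerE ffunE.
rewrite [X in X \in _]kE map_f// mem_enum.
by apply/forallP => u; apply/forallP => v; apply/implyP => /pk; rewrite !ffunE.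
Qed.
End Truncation.

(** A monomial involves finitely many variables. *)
Lemma eq_truncate (f g : fpseries) :
  (forall N, truncate N f = truncate N g) -> f = g.
Proof.
move=> fg; apply/funext => M.
pose N := (\max_(i <- M : seq nat) i).+1.
have sM : small N M.
  by apply/allP => i iM; rewrite ltnS; exact: (@leq_bigmax_seq _ _ xpredT id).
by have := congr1 (fun h : fpseries => h M) (fg N); rewrite /truncate sM.
Qed.

(** * The dumbbell graph *)

Lemma truncate_path N k :
  truncate N (chromsym (path_graph k)) = path_sum (fun c : 'I_N => fpvar c) k.
Proof. by rewrite truncate_chromsym colour_sum_path. Qed.

Lemma truncate_cycle N k : (1 < k)%N ->
  truncate N (chromsym (cycle_graph k)) = cycle_sum (fun c : 'I_N => fpvar c) k.
Proof. by move=> k1; rewrite truncate_chromsym colour_sum_cycle. Qed.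

Lemma truncate_dumbbell N m (l : int) n :
    (1 < m.+1)%N -> (1 < n.+1)%N -> -1 <= l ->
  let x := fun c : 'I_N => fpvar c in
  truncate N (chromsym (dumbbell_graph m.+1 l n.+1)) =
  pairing x (returns x m.+1) (iter (absz (l + 1)) (step x) (returns x n.+1)).
Proof.
move=> m1 n1; rewrite truncate_chromsym; case: l => [l|[|l]] // _ x.
  by rewrite colour_sum_dumbbell// -PoszD addn1.
exact: colour_sum_wedge.
Qed.

Theorem theorem4p7 (m n : nat) (l : int)
    (hm : (3 <= m)%N) (hn : (3 <= n)%N) (hl : -1 <= l) :
  chromsym (dumbbell_graph m l n) =
    (m%:R - 1) * (n%:R - 1) * chromsym (path_graph (absz (m%:Z + l + n%:Z)%R))
    - (m%:R - 1) * \sum_(2 <= i < n)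
        chromsym (path_graph (absz (m%:Z + l + n%:Z - i%:Z)%R))
        * chromsym (cycle_graph i)
    - (n%:R - 1) * \sum_(2 <= j < m)
        chromsym (path_graph (absz (m%:Z + l + n%:Z - j%:Z)%R))
        * chromsym (cycle_graph j)
    + \sum_(2 <= i < n) \sum_(2 <= j < m)
        chromsym (path_graph (absz (m%:Z + l + n%:Z - i%:Z - j%:Z)%R))
        * chromsym (cycle_graph i) * chromsym (cycle_graph j).
Proof.
case: m hm => // m hm; case: n hn => // n hn.
have {hm hn} [m1 n1] : (1 < m.+1)%N /\ (1 < n.+1)%N by split; exact: ltnW.
rewrite -![_.+1%:R]natr1 !addrK.
apply: eq_truncate => N; rewrite truncate_dumbbell// dumbbell_sumE.
rewrite rmorphD !rmorphB !rmorphM !rmorph_nat !rmorph_sum.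
set p := (absz (l + 1)); set x := fun c : 'I_N => fpvar c.
have lE : l = p%:Z - 1 by rewrite /p; lia.
rewrite lE; congr (_ * _ - _ * _ - _ * _ + _).
- by rewrite /= (_ : absz _ = (m + p + n).+1) ?truncate_path//; lia.
- rewrite !big_nat; apply: eq_bigr => i /andP[i1 ltin].
  rewrite (_ : absz _ = (m + p + n - i).+1); last by lia.
  by rewrite rmorphM /= truncate_path truncate_cycle.
- rewrite !big_nat; apply: eq_bigr => j /andP[j1 ltjm].
  rewrite (_ : absz _ = (m + p + n - j).+1); last by lia.
  by rewrite rmorphM /= truncate_path truncate_cycle.
rewrite !big_nat; apply: eq_bigr => i /andP[i1 ltin].
rewrite rmorph_sum !big_nat; apply: eq_bigr => j /andP[j1 ltjm].
rewrite (_ : absz _ = (m + p + n - i - j).+1); last by lia.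
by rewrite !rmorphM /= truncate_path !truncate_cycle.
Qed.
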